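(* Let $(X,\rho)$ be a complete metric space and let $\alpha\ge 0$ be a real number. The following statements are equivalent: (1) $\dim_{ML}X>\alpha$; (2) there are integers $k,l\ge 2$ with $\frac{\log l}{k\log 2}>\alpha$ such that $X$ contains a $(k,l)$-regular set.
   Context: Subsets of a metric space are regarded as metric spaces with the inherited metric. For a metric space $(X,\rho)$, $B(x,r)=\{y\in X:\rho(x,y)\le r\}$ denotes the closed ball in $X$, and $N_r(A)\in\{0,1,2,\dots\}\cup\{\infty\}$ denotes the minimal number of sets of diameter at most $r$ required to cover $A\subset X$. The lower dimension of a metric space $X$ with at least two points is $$\dim_L X=\sup\Big\{\alpha\in\mathbb{R}:\ \exists\, C>0 \text{ such that for all real } 0<r<R\le\operatorname{diam}X \text{ and all } x\in X,\ N_r(B(x,R))\ge C\left(\tfrac{R}{r}\right)^{\alpha}\Big\}\in[0,\infty],$$ where $\operatorname{diam}X$ may be $\infty$. Conventions: $\dim_L\emptyset=0$, and $\dim_L X=0$ if $X$ is a one-point space. The modified lower dimension of a metric space $X$ is $\dim_{ML}X=\sup\{\dim_L E: E\subset X\}$. Sequences: $\mathbb{N}=\{0,1,2,\dots\}$; a natural number $l$ is identified with $\{0,1,\dots,l-1\}$; $l^n$ is the set of functions from $n$ into $l$ (sequences of length $n$ with entries in $\{0,\dots,l-1\}$), so $l^0=\{\emptyset\}$; $l^{<\omega}=\bigcup_{n\in\mathbb{N}}l^n$. Let $k,l\ge 2$ be integers. A family $\{y_s\}_{s\in l^{<\omega}}$ of points of $X$ is a $(k,l)$-regular set if for all $n\in\mathbb{N}$: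 (i) $\rho(y_s,y_t)\le 2^{-kn-1}$ whenever $s\in l^n$, $t\in l^{n+1}$ and $t$ extends $s$; (ii) $\rho(y_s,y_t)\ge 2^{-kn+2}$ whenever $s,t\in l^n$ and $s\ne t$. *)

(* Defs.v *)
From HB Require Import structures.
From mathcomp Require Import all_boot all_order all_algebra.
From mathcomp Require Import all_classical all_reals all_analysis.

Set Implicit Arguments.
Unset Strict Implicit.
Unset Printing Implicit Defensive.

Import Order.TTheory GRing.Theory Num.Theory.

Local Open Scope classical_set_scope.
Local Open Scope ring_scope.

(** A subset [E] of a metric space, as a type, already carries the induced
    pseudometric structure of the library; this adds the inherited distance. *)
Section inherited_metric.
Context {R : realType} {X : metricType R} (E : set X).

Definition sub_mdist (x y : set_type E) : R := mdist (\val x) (\val y).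

Let sub_mdist_ge0 x y : 0 <= sub_mdist x y.
Proof. exact: mdist_ge0. Qed.

Let sub_mdist_positivity x y : sub_mdist x y = 0 -> x = y.
Proof. by move=> /mdist_positivity/val_inj. Qed.

Let sub_ballEmdist (x : set_type E) d : ball x d = [set y | sub_mdist x y < d].
Proof. by rewrite -initial_ballE ballEmdist. Qed.

HB.instance Definition _ := PseudoMetric_isMetric.Build R (set_type E)
  sub_mdist_ge0 sub_mdist_positivity sub_ballEmdist.

End inherited_metric.

Section metric_notions.
Context {R : realType}.
Implicit Type X : metricType R.

(** The library's [completeType] is pointed, which would exclude the empty
    space; completeness is therefore a predicate on [metricType]. *)
Definition complete_metric X : Prop :=
  forall u : nat -> X, cauchy (u @ \oo) -> exists x : X, u @ \oo --> x.

(** The library's [closed_ball] is the closure of the open ball, which in a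
    general metric space may be strictly smaller than this set. *)
Definition cball X (x : X) (r : R) : set X := [set y | mdist x y <= r].

(** [0%E] is added so that the empty set has diameter [0] and not [-oo]. *)
Definition diam X (A : set X) : \bar R :=
  ereal_sup (0%E |` [set (mdist x y)%:E | x in A & y in A]).

(** The value is [+oo] when there is no finite cover, as [ereal_inf set0]. *)
Definition covering_number X (r : R) (A : set X) : \bar R :=
  ereal_inf [set n%:R%:E | n in
    [set n : nat | exists C : 'I_n -> set X,
       (forall i, (diam (C i) <= r%:E)%E) /\ A `<=` \bigcup_i C i]].

Definition lower_dim X : \bar R :=
  if `[< exists x y : X, x <> y >] then
    ereal_sup [set a%:E | a in
      [set a : R | exists2 C : R, 0 < C &
         forall r s : R, 0 < r -> r < s -> (s%:E <= diam [set: X])%E ->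
         forall x : X,
           ((C * (s / r) `^ a)%:E <= covering_number r (cball x s))%E]]
  else 0%E.

Definition modified_lower_dim X : \bar R :=
  ereal_sup [set lower_dim (set_type E : metricType R) | E in [set: set X]].

(** [l^n] is the set of [s : seq 'I_l] with [size s = n]; the exponents of [2]
    are integers. *)
Definition regular_set X (k l : nat) (y : seq 'I_l -> X) : Prop :=
  forall n : nat,
    (forall s t : seq 'I_l, size s = n -> size t = n.+1 -> prefix s t ->
       mdist (y s) (y t) <= 2 ^ (- (k * n)%:Z - 1)) /\
    (forall s t : seq 'I_l, size s = n -> size t = n -> s <> t ->
       2 ^ (- (k * n)%:Z + 2) <= mdist (y s) (y t)).

End metric_notions.

(* Main.v *)
Require Import Defs.
From HB Require Import structures.
From mathcomp Require Import all_boot all_order all_algebra.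
From mathcomp Require Import all_classical all_reals all_analysis.
From mathcomp Require Import ring lra.

Set Implicit Arguments.
Unset Strict Implicit.
Unset Printing Implicit Defensive.

Import Order.TTheory GRing.Theory Num.Theory.

Local Open Scope classical_set_scope.
Local Open Scope ring_scope.

(** If some subset E has lower dimension > alpha, then for large k each ball of
    E of radius about 2^(-kn) contains l > 2^(k alpha) points separated at scale
    2^(-k(n+1)); choosing such points recursively yields a regular set.
    Conversely, in a complete space the points of a (k,l)-regular set converge
    along every branch, and the set of limits is a copy of the Cantor set of
    infinite l-ary sequences, where branches that first differ at index n have
    limits at distance comparable to 2^(-kn); counting the branches through a
    node gives lower dimension >= log l / (k log 2). *)

(** * Covering numbers versus separated families *)

Lemma mdist_le_diam (R : realType) (X : metricType R) (A : set X) (x y : X) :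
  A x -> A y -> ((mdist x y)%:E <= diam A)%E.
Proof.
by move=> Ax Ay; apply: ereal_sup_ubound; right; exists x => //; exists y.
Qed.

Lemma diam_le (R : realType) (X : metricType R) (A : set X) (r : R) :
  0 <= r -> (forall x y, A x -> A y -> mdist x y <= r) -> (diam A <= r%:E)%E.
Proof.
move=> r0 Ar; apply: ge_ereal_sup => z /= [->|]; first by rewrite lee_fin.
by move=> [x Ax [y Ay <-]]; rewrite lee_fin Ar.
Qed.

(** A set of diameter at most [r] contains at most one of the points [g t], so sending [t] to the
    index of a covering set that contains [g t] is injective. *)
Lemma covering_number_ge_card (R : realType) (X : metricType R) (T : finType)
    (g : T -> X) (A : set X) (r : R) :
  (forall t, A (g t)) -> (forall t u, t != u -> r < mdist (g t) (g u)) ->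
  (#|T|%:R%:E <= covering_number r A)%E.
Proof.
move=> gA gsep; apply: le_ereal_inf_tmp => _ [n [C [Cdiam AC]] <-].
rewrite lee_fin ler_nat.
have /choice[f fP] : forall t, exists i, C i (g t).
  by move=> t; have [i _ Ci] := AC _ (gA t); exists i.
suff finj : injective f by have := leq_card f finj; rewrite card_ord.
move=> t u ftu; apply/eqP/negPn/negP => /gsep; rewrite ltNge => /negP; apply.
rewrite -lee_fin; apply: le_trans (Cdiam (f t)).
by apply: mdist_le_diam => //; rewrite ftu.
Qed.

(** Greedy choice: the open balls of radius [r] around [m < l] chosen points have diameter at most
    [2 * r], so they cannot cover [A], and any uncovered point can be added. *)
Lemma separated_of_covering_number (R : realType) (X : metricType R)
    (A : set X) (r : R) (l : nat) :
  0 <= r -> (l%:R%:E <= covering_number (2 * r) A)%E ->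
  exists g : 'I_l -> X, (forall i, A (g i)) /\
    (forall i j, i != j -> r <= mdist (g i) (g j)).
Proof.
move=> r0 lA; suff: forall m, (m <= l)%N -> exists g : 'I_m -> X,
  (forall i, A (g i)) /\ (forall i j, i != j -> r <= mdist (g i) (g j)).
  by move=> /(_ l (leqnn l)).
elim=> [_|m IH ml]; first by exists (fun i : 'I_0 => False_rect X (notF (ltn_ord i))); split => [] [].
have [g [gA gsep]] := IH (ltnW ml).
have [x Ax gx] : exists2 x, A x & forall i, r <= mdist (g i) x.
  apply: contrapT => ncov.
  have : (covering_number (2 * r) A <= m%:R%:E)%E.
    apply: ereal_inf_lbound; exists m => //.
    exists (fun i => [set x | mdist (g i) x < r]); split => [i|x Ax].
      apply: diam_le => [|x y /= gx gy]; first by rewrite mulr_ge0.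
      have := metric_triangle x (g i) y; rewrite (metric_sym x (g i)).
      by move: (mdist _ _) (mdist _ _) (mdist _ _) gx gy => a b c; lra.
    apply: contrapT => nx; apply: ncov; exists x => // i.
    by rewrite leNgt; apply/negP => gx; apply: nx; exists i.
  move=> /(le_trans lA); rewrite lee_fin ler_nat.
  by rewrite leqNgt ml.
exists (fun i => if unlift ord_max i is Some j then g j else x); split.
  by move=> i; case: unliftP => [j|] _.
move=> i i'; case: unliftP => [j|] ->; case: unliftP => [j'|] -> //.
- by rewrite (inj_eq lift_inj) => /gsep.
- by rewrite metric_sym.
- by rewrite eqxx.
Qed.

(** * Powers and geometrically convergent sequences *)

Lemma exprn_eventually_gt (R : realType) (b M : R) : 1 < b ->
  exists N, forall k, (N <= k)%N -> M < b ^+ k.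
Proof.
move=> b1; have b0 : 0 < b by apply: lt_trans b1.
have [M0|M0] := leP M 0; first by exists 0%N => k _; rewrite (le_lt_trans M0) ?exprn_gt0.
exists (Num.trunc (ln M / ln b)).+1 => k kN.
have lnb : 0 < ln b by rewrite ln_gt0.
rewrite -ltr_ln ?posrE ?exprn_gt0 // lnXn // -mulr_natl -ltr_pdivrMr //.
by apply: lt_le_trans (truncnS_gt _) _; rewrite ler_nat.
Qed.

Lemma exprn_eventually_lt (R : realType) (e eps : R) : 0 < e < 1 -> 0 < eps ->
  exists N, forall k, (N <= k)%N -> e ^+ k < eps.
Proof.
move=> /andP[e0 e1] eps0.
have [|N HN] := @exprn_eventually_gt R e^-1 eps^-1; first by rewrite invf_gt1.
exists N => k /HN; rewrite exprVn ltf_pV2 // posrE ?exprn_gt0 //.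
Qed.

Lemma geometric_seq_limit (R : realType) (X : metricType R) (e : R)
    (u : nat -> X) :
  complete_metric X -> 0 < e <= 2^-1 ->
  (forall n, mdist (u n) (u n.+1) <= e ^+ n / 2) ->
  exists x, forall n, mdist (u n) x <= e ^+ n.
Proof.
move=> hX /andP[e0 e12] ustep.
have e1 : 0 < e < 1 by rewrite e0 /=; lra.
(* The telescoping form makes the induction close: [e <= 1/2] gives
   [e ^+ m / 2 <= e ^+ m - e ^+ m.+1]. *)
have uD n p : mdist (u n) (u (n + p)%N) <= e ^+ n - e ^+ (n + p).
  elim: p => [|p IH]; first by rewrite addn0 mdistxx subrr.
  have := metric_triangle (u n) (u (n + p)%N) (u (n + p.+1)%N).
  have := ustep (n + p)%N; rewrite addnS exprS.
  have := exprn_gt0 (n + p) e0.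
  move: (mdist _ _) (mdist _ _) (mdist _ _) (e ^+ _) (e ^+ _) IH => a b c f g.
  by nra.
have ule n m : (n <= m)%N -> mdist (u n) (u m) <= e ^+ n.
  move=> nm; rewrite -(subnKC nm); apply: le_trans (uD _ _) _.
  by rewrite gerBl exprn_ge0 // ltW.
have [x ux] : exists x : X, u @ \oo --> x.
  apply: hX; apply/cauchy_ballP => eps eps0.
  have [N HN] := exprn_eventually_lt e1 eps0.
  have near_u : \forall n \near \oo & m \near \oo, ball (u n) eps (u m).
    exists (`[N, +oo[%classic, `[N, +oo[%classic) => /=.
      by split; exists N => // n /= Nn; rewrite in_itv /= andbT.
    move=> [n m] [/=]; rewrite !in_itv /= !andbT => Nn Nm.
    rewrite ballEmdist /=.
    case/orP: (leq_total n m) => nm.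
      exact: le_lt_trans (ule _ _ nm) (HN _ Nn).
    by rewrite metric_sym; apply: le_lt_trans (ule _ _ nm) (HN _ Nm).
  by rewrite near_map2.
exists x => n; apply/ler_addgt0Pl => eps eps0.
have := cvg_ball ux eps0; rewrite /= => -[N _ HN].
have := HN (maxn n N) (leq_maxr _ _); rewrite ballEmdist /= metric_sym => H.
apply: le_trans (metric_triangle _ (u (maxn n N)) _) _.
by rewrite addrC lerD ?ule ?leq_maxl // ltW.
Qed.

(** * Lower dimension of a space coded by infinite words *)

Lemma lower_dim_ge_of_coding (R : realType) (Y : metricType R) (l : nat) (e : R)
    (z : (nat -> 'I_l) -> Y) :
  (2 <= l)%N -> 0 < e < 1 -> (forall x, exists b, z b = x) ->
  (forall n b b', mkseq b n = mkseq b' n -> mdist (z b) (z b') <= 2 * e ^+ n) ->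
  (forall n b b', mkseq b n <> mkseq b' n -> 2 * e ^+ n <= mdist (z b) (z b')) ->
  ((ln l%:R / ln e^-1)%:E <= lower_dim Y)%E.
Proof.
move=> l2 e01 zsurj zle zge; have /andP[e0 e1] := e01.
have lne : 0 < ln e^-1 by rewrite ln_gt0 // invf_gt1.
have l0 : 0 < l%:R :> R by rewrite ltr0n (leq_trans _ l2).
set a := ln l%:R / ln e^-1.
have a0 : 0 <= a by rewrite divr_ge0 ?(ltW lne) // ln_ge0 // ler1n ltnW.
have ea : e^-1 `^ a = l%:R.
  by rewrite /powR gt_eqF ?invr_gt0 // /a divfK ?gt_eqF // lnK.
rewrite /lower_dim ifT; last first.
  apply/asboolP.
  exists (z (fun=> Ordinal (ltnW l2))), (z (fun=> Ordinal l2)) => zz.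
  have := zge 1%N (fun=> Ordinal (ltnW l2)) (fun=> Ordinal l2).
  by rewrite zz mdistxx => /(_ ltac:(by [])); rewrite leNgt mulr_gt0 ?exprn_gt0.
(* The constant [l ^- 2] pays for the two levels lost when [s] and [r] are rounded to the scales
   [2 * e ^+ n]. *)
apply: ereal_sup_ubound; exists a => //; exists (l%:R ^- 2).
  by rewrite invr_gt0 exprn_gt0.
move=> r s r0 rs sdiam x; have [b <-] := zsurj x.
have s0 : 0 < s := lt_trans r0 rs.
have s2 : s <= 2.
  rewrite -lee_fin; apply: le_trans sdiam _; apply: diam_le => // x1 x2 _ _.
  have [b1 <-] := zsurj x1; have [b2 <-] := zsurj x2.
  by have := @zle 0%N b1 b2 erefl; rewrite expr0 mulr1.
have scale (t : R) : 0 < t -> exists n, 2 * e ^+ n <= t.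
  move=> t0; have [|N HN] := exprn_eventually_lt e01 (eps := t / 2).
    by rewrite divr_gt0.
  by exists N; have := HN _ (leqnn N); lra.
(* Words agreeing with [b] on [n] letters stay in the ball of radius [s], and words differing before
   index [m'] are more than [r] apart when [m' > 0]. *)
have [n nP nmin] := ex_minnP (scale s s0).
have [|m' mP mmin] := @ex_minnP (fun m => 2 * e ^+ m.+1 <= r).
  have [N HN] := scale r r0; exists N; apply: le_trans HN.
  by rewrite ler_wpM2l // exprS ger_pMl ?exprn_gt0 // ltW.
(* Truncated subtraction: if [m' <= n] then [p = 0], and the single point [z b] gives the bound. *)
pose p := (m' - n)%N.
have sr : s / r <= e^-1 ^+ p.+2.
  rewrite ler_pdivrMr // exprVn mulrC ler_pdivlMr ?exprn_gt0 //.
  (* For [n = 0] minimality says nothing; the diameter bound [s <= 2] replaces it. *)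
  have se : s * e <= 2 * e ^+ n.
    case: n nmin {nP p} => [|n] nmin.
      by rewrite expr0 mulr1; apply: le_trans s2; rewrite ger_pMr // ltW.
    rewrite exprSr mulrA ler_pM2r // leNgt; apply/negP => /ltW/nmin.
    by rewrite ltnn.
  rewrite exprS mulrA; apply: le_trans mP.
  apply: (@le_trans _ _ (2 * e ^+ n * e ^+ p.+1)).
    by rewrite ler_pM2r // exprn_gt0.
  rewrite -mulrA ler_pM2l // -exprD ler_wiXn2l ?(ltW e0) ?(ltW e1) //.
  by rewrite addnS ltnS -leq_subLR.
apply: (@le_trans _ _ ((l ^ p)%:R%:E)).
  rewrite lee_fin mulrC ler_pdivrMr ?exprn_gt0 // natrX -exprD addn2.
  apply: (@le_trans _ _ ((e^-1 ^+ p.+2) `^ a)).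
    apply: ge0_ler_powR => //; rewrite nnegrE.
      by rewrite divr_ge0 ?ltW.
    by rewrite exprn_ge0 // invr_ge0 ltW.
  rewrite -powR_mulrn ?invr_ge0 ?(ltW e0) // powRAC ea powR_mulrn //.
have <- : #|{: p.-tuple 'I_l}| = (l ^ p)%N by rewrite card_tuple card_ord.
(* This is [b] with the letters at indices from [n] to [n + p - 1] replaced by [w]; the default of
   [nth] restores [b] beyond them. *)
pose ext (w : p.-tuple 'I_l) (i : nat) : 'I_l :=
  if (i < n)%N then b i else nth (b i) w (i - n).
apply: (@covering_number_ge_card _ _ _ (z \o ext)) => [w|w w' ww'] /=.
  rewrite /cball /=; apply: le_trans nP; apply: zle; apply/eq_in_map => i.
  by rewrite mem_iota add0n /ext => /andP[_ ->].
(* Two distinct tuples exclude [p = 0], so [m' > 0] and minimality of [m'] applies. *)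
have p0 : (0 < p)%N.
  rewrite lt0n; apply: contra_neqN ww' => /eqP p0.
  apply: val_inj; apply: (@eq_from_nth _ (b 0%N)); first by rewrite !size_tuple.
  by move=> i; rewrite size_tuple => ip; rewrite p0 in ip.
have nm : (n < m')%N by rewrite -subn_gt0.
have rm : r < 2 * e ^+ m'.
  case: m' mmin nm {mP p sr ext w w' ww' p0} => // m' mmin _.
  by rewrite ltNge; apply/negP => /mmin; rewrite ltnn.
apply: lt_le_trans rm _; apply: zge => /eqP; apply/negP; apply: contra_neqN ww'.
move=> /eqP ww'; apply: val_inj; apply: (@eq_from_nth _ (b 0%N)).
  by rewrite !size_tuple.
move=> i; rewrite size_tuple => ip.
have im : (n + i < m')%N by rewrite -ltn_subRL.
have := congr1 (nth (b 0%N) ^~ (n + i)%N) ww'.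
rewrite !nth_mkseq // /ext ltnNge leq_addr /= addKn.
by rewrite !(set_nth_default (b 0%N) (b (n + i)%N)) ?size_tuple.
Qed.

(** * From a regular set to a lower bound on the dimension *)

Lemma pow2N (R : realType) (k n : nat) :
  (2 : R) ^ (- (k * n)%:Z) = (2^-1 ^+ k) ^+ n.
Proof. by rewrite -exprnN -exprVn exprM. Qed.

(** Passes to the ratio [e = 2^-k] in which all later estimates are made; a pair rather than a
    conjunction, so that it can serve as one rewriting multirule. *)
Lemma regular_set_scaleE (R : realType) (k n : nat) :
  ((2 : R) ^ (- (k * n)%:Z - 1) = (2^-1 ^+ k) ^+ n / 2) *
  ((2 : R) ^ (- (k * n)%:Z + 2) = 4 * (2^-1 ^+ k) ^+ n).
Proof.
by rewrite !expfzDr ?pnatr_eq0 // pow2N exprN1; split => //; rewrite mulrC;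
  congr (_ * _); ring.
Qed.

Lemma half_pow_le (R : realType) (k : nat) : (2 <= k)%N ->
  (2^-1 ^+ k : R) <= 4^-1.
Proof.
move=> k2; have -> : 4^-1 = 2^-1 ^+ 2 :> R by field.
by rewrite ler_wiXn2l //; lra.
Qed.

Lemma regular_set_modified_lower_dim (R : realType) (X : metricType R)
    (k l : nat) (y : seq 'I_l -> X) :
  complete_metric X -> (2 <= k)%N -> (2 <= l)%N -> regular_set k y ->
  ((ln l%:R / (k%:R * ln 2))%:E <= modified_lower_dim X)%E.
Proof.
move=> hX k2 l2 yreg; set e : R := 2^-1 ^+ k.
have e0 : 0 < e by rewrite exprn_gt0 // invr_gt0.
have e4 : e <= 4^-1 by apply: half_pow_le.
have /choice[z zP] (b : nat -> 'I_l) : exists x : X,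
    forall n, mdist (y (mkseq b n)) x <= e ^+ n.
  apply: (geometric_seq_limit hX); first by rewrite e0 /=; lra.
  move=> n; rewrite -(regular_set_scaleE R k n).1; have [+ _] := yreg n.
  by apply; rewrite ?size_mkseq // mkseqS prefix_rcons.
have zle n b b' : mkseq b n = mkseq b' n -> mdist (z b) (z b') <= 2 * e ^+ n.
  move=> bb'; have := metric_triangle (z b) (y (mkseq b n)) (z b').
  have := zP b' n; have := zP b n; rewrite -bb' (metric_sym (z b) (y _)).
  by move: (mdist _ _) (mdist _ _) (mdist _ _) => u v w; lra.
(* The nodes are [4 * e ^+ n] apart and each limit lies within [e ^+ n] of its node, which leaves
   [2 * e ^+ n]. *)
have zge n b b' : mkseq b n <> mkseq b' n -> 2 * e ^+ n <= mdist (z b) (z b').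
  move=> bb'; have [_ /(_ _ _ _ _ bb')] := yreg n.
  rewrite !size_mkseq (regular_set_scaleE R k n).2 -/e => /(_ erefl erefl).
  have := metric_triangle (y (mkseq b n)) (z b) (y (mkseq b' n)).
  have := metric_triangle (z b) (z b') (y (mkseq b' n)).
  have := zP b' n; have := zP b n; rewrite (metric_sym (z b') (y _)).
  move: (mdist _ _) (mdist _ _) (mdist _ _) (mdist _ _) (mdist _ _).
  by move=> u v w t s; lra.
pose E := range z.
have Ez b : z b \in E by apply/mem_set; exists b.
pose zE (b : nat -> 'I_l) : set_type E := SigSub (Ez b).
apply: (@le_trans _ _ (lower_dim (set_type E))); last first.
  by apply: ereal_sup_ubound; exists E.
have <- : ln e^-1 = k%:R * ln 2 :> R by rewrite /e exprVn invrK lnXn // mulr_natl.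
apply: (@lower_dim_ge_of_coding _ _ _ _ zE) => //.
- by rewrite e0 /=; lra.
- move=> [x Ex]; have [b _ zb] := set_mem Ex.
  by exists b; apply: val_inj.
Qed.

(** * From large dimension to a regular set *)

Lemma regular_set_of_branching (R : realType) (X : metricType R) (k l : nat)
    (x0 : X) :
  (2 <= k)%N ->
  (forall n x, exists g : 'I_l -> X,
    (forall i, mdist x (g i) <= (2^-1 ^+ k) ^+ n / 2) /\
    (forall i j, i != j ->
       4 * (2^-1 ^+ k) ^+ n.+1 <= mdist (g i) (g j))) ->
  exists y : seq 'I_l -> X, regular_set k y.
Proof.
move=> k2 branch; set e : R := 2^-1 ^+ k in branch *.
have e0 : 0 < e by rewrite exprn_gt0 // invr_gt0.
have e4 : e <= 4^-1 by apply: half_pow_le.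
have /choice[f fP] (p : nat * X) := branch p.1 p.2.
(* The level is carried along with the point because it fixes the scale of the next branching. *)
pose state := foldl (fun p i => (p.1.+1, f p i)) (0%N, x0).
have state1 s : (state s).1 = size s.
  by elim/last_ind: s => // s i IH; rewrite /state foldl_rcons size_rcons /= -IH.
pose y s := (state s).2; exists y.
have yS s i : y (rcons s i) = f (size s, y s) i.
  by rewrite /y {1}/state foldl_rcons /= -/(state s) -state1 -surjective_pairing.
have ystep s i : mdist (y s) (y (rcons s i)) <= e ^+ size s / 2.
  by rewrite yS; apply: (fP (size s, y s)).1.
move=> n; rewrite !(regular_set_scaleE R k n) -/e; split.
  move=> s t sn tn /prefixP[w tE].
  have : size w = 1%N.
    by apply/eqP; rewrite -(eqn_add2l (size s)) -size_cat -tE tn sn addn1.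
  move: w tE => [|i []] // -> _; rewrite cats1 -sn; exact: ystep.
elim: n => [|n IH] s t; first by move=> /size0nil -> /size0nil ->.
elim/last_ind: s => // s i _; elim/last_ind: t => // t j _.
rewrite !size_rcons => -[sn] [tn] st.
have [eq_st|/eqP ne_st] := eqVneq s t.
  rewrite !yS eq_st -tn; apply: (fP (size t, y t)).2.
  by apply/eqP => ij; apply: st; rewrite eq_st ij.
(* Distinct parents are [4 * e ^+ n] apart and each child moves by at most [e ^+ n / 2]; the
   remaining [3 * e ^+ n] exceeds [4 * e ^+ n.+1] since [e <= 1/4]. *)
have := IH _ _ sn tn ne_st; have := ystep s i; have := ystep t j.
rewrite sn tn exprS.
have := metric_triangle (y s) (y (rcons s i)) (y t).
have := metric_triangle (y (rcons s i)) (y (rcons t j)) (y t).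
rewrite (metric_sym (y (rcons t j)) (y t)).
have := exprn_gt0 n e0; move: (e ^+ n) => E.
move: (mdist _ _) (mdist _ _) (mdist _ _) (mdist _ _) (mdist _ _).
by move=> a b c d u; nra.
Qed.

Lemma modified_lower_dim_gt (R : realType) (X : metricType R) (alpha : R) :
  0 <= alpha -> (alpha%:E < modified_lower_dim X)%E ->
  exists E : set X, exists a C : R,
    [/\ alpha < a, 0 < C, exists x y : set_type E, x <> y &
      forall r s : R, 0 < r -> r < s -> (s%:E <= diam [set: set_type E])%E ->
         forall x : set_type E,
           ((C * (s / r) `^ a)%:E <= covering_number r (cball x s))%E].
Proof.
move=> alpha0 /ereal_sup_gt[_ [E _ <-]]; rewrite /lower_dim.
(* With fewer than two points the dimension is [0], which cannot exceed [alpha >= 0]. *)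
case: asboolP => [E2|_]; last by rewrite lte_fin ltNge alpha0.
move=> /ereal_sup_gt[_ [a [C C0 HC] <-]]; rewrite lte_fin => aa.
by exists E, a, C.
Qed.

(** The right-hand bound on [l] grows like [2 ^ (k a)], which eventually beats twice [2 ^ (k alpha)]
    because [a > alpha]; this leaves room for an integer [l] just above [2 ^ (k alpha)]. *)
Lemma regular_set_parameters (R : realType) (alpha a C d : R) :
  0 <= alpha -> alpha < a -> 0 < C -> 0 < d ->
  exists k l : nat, [/\ (2 <= k)%N, (2 <= l)%N,
    alpha < ln l%:R / (k%:R * ln 2), 1 < d * 2 ^+ k &
    l%:R <= C * (d * 2 ^+ k) `^ a].
Proof.
move=> alpha0 aa C0 d0.
have ln2 : 0 < ln 2 :> R by rewrite ln_gt0 // ltr1n.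
have b1 : 1 < 2 `^ (a - alpha) :> R.
  by rewrite /powR gt_eqF // expR_gt1 mulr_gt0 // subr_gt0.
have Cda0 : 0 < C * d `^ a by rewrite mulr_gt0 // powR_gt0.
have [N1 HN1] := exprn_eventually_gt (2 / (C * d `^ a)) b1.
have [N2 HN2] := @exprn_eventually_gt R 2 d^-1 ltac:(by rewrite ltr1n).
pose k := maxn 2 (maxn N1 N2).
have := HN1 k; have := HN2 k; rewrite !leq_max !leqnn !orbT => /(_ isT) k2 /(_ isT) k1.
pose t : R := 2 `^ (k%:R * alpha).
have t1 : 1 <= t by rewrite -(powRr0 (2 : R)) ler_powR ?ler1n // mulr_ge0.
have t0 : 0 < t by apply: lt_le_trans t1.
have /andP[tl tu] := truncn_itv (ltW t0).
have k0 : (0 < k)%N by rewrite !leq_max.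
(* This [l] satisfies [t < l <= t + 1 <= 2 * t], whence the factor [2] in the threshold for [N1]. *)
exists k, (Num.trunc t).+1; split.
- by rewrite leq_max leqnn.
- by rewrite ltnS; have := truncn_le_nat t 0; rewrite ltNge t1 leqNgt => /negbFE.
- rewrite ltr_pdivlMr ?mulr_gt0 ?ltr0n //.
  have -> : alpha * (k%:R * ln 2) = ln t by rewrite ln_powR; ring.
  by rewrite ltr_ln ?posrE ?ltr0n.
- by rewrite mulrC -ltr_pdivrMr // div1r.
- rewrite -natr1; apply: (@le_trans _ _ (2 * t)); first lra.
  have -> : C * (d * 2 ^+ k) `^ a = (C * d `^ a) * (2 `^ (a - alpha)) ^+ k * t.
    rewrite powRM ?exprn_ge0 ?(ltW d0) // -!powR_mulrn ?powR_ge0 // -powRrM.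
    rewrite -!mulrA; congr (_ * (_ * _)); rewrite -powRrM /t -powRD ?pnatr_eq0 ?implybT //.
    by congr (_ `^ _); ring.
  rewrite ler_pM2r //; move: k1; rewrite ltr_pdivrMr // mulrC.
  exact: ltW.
Qed.

Lemma modified_lower_dim_regular_set (R : realType) (X : metricType R)
    (alpha : R) :
  0 <= alpha -> (alpha%:E < modified_lower_dim X)%E ->
  exists k l : nat, [/\ (2 <= k)%N, (2 <= l)%N,
    alpha < ln l%:R / (k%:R * ln 2) &
    exists y : seq 'I_l -> X, regular_set k y].
Proof.
move=> alpha0 /(modified_lower_dim_gt alpha0).
move=> [E [a [C [aa C0 [x0 [x1 x01]] HC]]]].
(* [d <= 1] will keep the children within [e ^+ n / 2], and [d <= mdist x0 x1] makes the radius [s]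
   admissible for the diameter of [E]. *)
pose d := Num.min 1 (mdist x0 x1).
have d0 : 0 < d by rewrite lt_min ltr01 mdist_gt0; apply/eqP.
(* The [16] comes from [s / r = (d * e ^+ n / 2) / (8 * e ^+ n.+1)] for the radii chosen below. *)
have [||||k [l [k2 l2 kl dk lC]]] := @regular_set_parameters R alpha a C (d / 16) => //.
  by rewrite divr_gt0.
exists k, l; split => //.
suff [y yreg] : exists y : seq 'I_l -> set_type E, regular_set k y.
  by exists (val \o y) => n; exact: yreg n.
apply: (regular_set_of_branching x0 k2) => n x; set e : R := 2^-1 ^+ k.
have e0 : 0 < e by rewrite exprn_gt0 // invr_gt0.
have en0 := exprn_gt0 n e0.
have e2 : 2 ^+ k = e^-1 by rewrite /e exprVn invrK.
rewrite {}e2 in dk lC.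
(* The covering scale [r] is twice the separation [4 * e ^+ n.+1] required of siblings. *)
pose r := 2 * (4 * e ^+ n.+1); pose s := d * (e ^+ n / 2).
have r0 : 0 < r by rewrite !mulr_gt0 ?exprn_gt0.
have srE : s / r = d / 16 * e^-1.
  by rewrite /s /r exprS; field; rewrite !gt_eqF.
have rs : r < s by rewrite -[r]mul1r -ltr_pdivlMr // srE.
have sd : s <= d.
  rewrite ger_pMr //; have : e ^+ n <= 1; last lra.
  apply: exprn_ile1; first exact: ltW.
  by have := half_pow_le R k2; rewrite -/e; lra.
have [] := @separated_of_covering_number _ _ (cball x s) (4 * e ^+ n.+1) l.
- by rewrite mulr_ge0 // exprn_ge0 // ltW.
- apply: le_trans (HC r s r0 rs _ x); first by rewrite lee_fin srE.
  apply: (@le_trans _ _ (mdist x0 x1)%:E); last exact: mdist_le_diam.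
  by rewrite lee_fin (le_trans sd) // ge_min lexx orbT.
- move=> g [gs gsep]; exists g; split => // i.
  apply: le_trans (gs i) _; rewrite ger_pMl ?divr_gt0 //.
  by rewrite ge_min lexx.
Qed.

Theorem theorem3p3 (R : realType) (X : metricType R)
    (hX : complete_metric X) (alpha : R) (halpha : 0 <= alpha) :
  (alpha%:E < modified_lower_dim X)%E <->
  (exists k l : nat,
     [/\ (2 <= k)%N, (2 <= l)%N,
         alpha < ln l%:R / (k%:R * ln 2) &
         exists y : seq 'I_l -> X, regular_set k y]).
Proof.
split; first exact: modified_lower_dim_regular_set.
move=> [k [l [k2 l2 kl [y yreg]]]].
apply: lt_le_trans (regular_set_modified_lower_dim hX k2 l2 yreg).
by rewrite lte_fin.
Qed.
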